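(* There exists an absolute constant $K>0$ with the following property. Let $H$ be a finite-dimensional complex Hilbert space, let $n\geqslant 1$, let $C>0$, and let $\{x_k\}_{k=1}^n$ and $\{y_k\}_{k=1}^n$ be finite sequences of vectors in $H$ such that $$\Big\|\sum_{k=1}^n \varepsilon_k\langle u, y_k\rangle x_k\Big\|\leqslant C\|u\|\quad\text{for all } u\in H \text{ and all } \varepsilon_1,\dots,\varepsilon_n\in\mathbb{C} \text{ with } |\varepsilon_k|\leqslant 1.$$ Then there exists a sequence of nonzero complex numbers $\{\alpha_k\}_{k=1}^n$ such that both $\{\alpha_k x_k\}_{k=1}^n$ and $\{\overline{\alpha}_k^{-1}y_k\}_{k=1}^n$ are $CK$-Bessel. (The constant $K$ does not depend on $H$, $n$, $C$, or the vectors.)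
   Context: The inner product $\langle\cdot,\cdot\rangle$ is linear in the first argument and conjugate-linear in the second. A finite sequence $\{z_k\}_{k=1}^n$ in $H$ is called $B$-Bessel if $\sum_{k=1}^n |\langle u, z_k\rangle|^2\leqslant B\|u\|^2$ for every $u\in H$. *)

(* Defs.v *)
From mathcomp Require Import all_boot all_order all_algebra.
From mathcomp Require Import complex reals.

Set Implicit Arguments.
Unset Strict Implicit.
Unset Printing Implicit Defensive.

Import Order.TTheory GRing.Theory Num.Theory Num.Def.
Local Open Scope ring_scope.
Local Open Scope complex_scope.

(* A finite-dimensional complex Hilbert space is a vector space
   [H : vectType R[i]] with a positive definite Hermitian form
   [dot : {dot H for conjC}], linear in its first argument and
   conjugate-linear in the second; completeness is automatic in finite
   dimension. Norms and moduli take their values in [R[i]], where [a <= b]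
   means that [b - a] is a nonnegative real. *)
Definition hnorm (R : realType) (H : vectType R[i]) (dot : {dot H for conjC})
  (u : H) : R[i] := sqrtC (dot u u).

Definition Bessel (R : realType) (H : vectType R[i]) (dot : {dot H for conjC})
  (n : nat) (B : R) (z : 'I_n -> H) : Prop :=
  forall u : H, \sum_(k < n) `|dot u (z k)| ^+ 2 <= B%:C * hnorm dot u ^+ 2.

(* Main.v *)
(* By phase alignment the hypothesis says
   [sum_k |<u, y_k>| |<v, x_k>| <= C |u| |v|]. Testing it on random signed sums
   of vectors and using Khinchine's inequality gives the vector-valued form
     [sum_k (sum_i |<v_i, x_k>|^2)^(1/2) (sum_i |<u_i, y_k>|^2)^(1/2)
        <= 4 C (sum_i |v_i|^2)^(1/2) (sum_i |u_i|^2)^(1/2)].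
   Weights [w_k = exp(s_k) = |alpha_k|^2] satisfying the two Bessel bounds on
   finitely many test vectors are then found by minimising the [l^p] sum of all
   the quantities to be bounded, for large [p]: at a critical point both halves
   of that sum equal the left-hand side above, for suitable multiples of the
   test vectors. Compactness of a box of exponents [s] passes from finitely many
   test vectors to all of [H]. *)
Require Import Defs.
From mathcomp Require Import all_boot all_order all_algebra.
From mathcomp Require Import complex reals.
From mathcomp Require Import ring lra.
From mathcomp Require Import finmap boolp classical_sets functions.
From mathcomp Require Import topology normedtype sequences derive realfun exp.

Set Implicit Arguments.
Unset Strict Implicit.
Unset Printing Implicit Defensive.

Import Order.TTheory GRing.Theory Num.Theory Num.Def.
Import numFieldNormedType.Exports.
Local Open Scope ring_scope.
Local Open Scope complex_scope.

(* The average of [F] over all the points [z + \sum_(v <- s) +/- v]. *)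
Fixpoint sign_avg (R : realType) (V : zmodType) (s : seq V) (F : V -> R) (z : V)
    : R :=
  if s is v :: s' then (sign_avg s' F (z + v) + sign_avg s' F (z - v)) / 2
  else F z.

(** * Averages over random signs *)

Section SignAverage.
Variables (R : realType) (V : zmodType).
Implicit Types (s : seq V) (F G : V -> R) (z : V).

Lemma sign_avg_le s F G z :
  (forall w, F w <= G w) -> sign_avg s F z <= sign_avg s G z.
Proof.
move=> FG; elim: s z => [|v s IH] z //=.
by have := IH (z + v); have := IH (z - v); lra.
Qed.

Lemma eq_sign_avg s F G z : F =1 G -> sign_avg s F z = sign_avg s G z.
Proof. by move=> FG; elim: s z => [|v s IH] z //=; rewrite !IH. Qed.

Lemma sign_avg_cst s (c : R) z : sign_avg s (fun=> c) z = c.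
Proof. by elim: s z => [|v s IH] z //=; rewrite !IH; lra. Qed.

Lemma sign_avgD s F G z :
  sign_avg s (fun w => F w + G w) z = sign_avg s F z + sign_avg s G z.
Proof. by elim: s z => [|v s IH] z //=; rewrite !IH; lra. Qed.

Lemma sign_avgZ s (c : R) F z :
  sign_avg s (fun w => c * F w) z = c * sign_avg s F z.
Proof. by elim: s z => [|v s IH] z //=; rewrite !IH; lra. Qed.

Lemma sign_avg_sum s (I : finType) (F : I -> V -> R) z :
  sign_avg s (fun w => \sum_i F i w) z = \sum_i sign_avg s (F i) z.
Proof.
elim: s z => [|v s IH] z //=.
by rewrite !IH -big_split/= big_distrl.
Qed.

Lemma sign_avg_ge0 s F z : (forall w, 0 <= F w) -> 0 <= sign_avg s F z.
Proof. by move=> F0; rewrite -(sign_avg_cst s 0 z) sign_avg_le. Qed.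

(** Nonnegativity of the variance: [(F w - c) ^+ 2] is averaged, with [c] the mean of [F]. *)
Lemma sign_avg_jensen s F z :
  sign_avg s F z ^+ 2 <= sign_avg s (fun w => F w ^+ 2) z.
Proof.
set c := sign_avg s F z.
have : 0 <= sign_avg s (fun w => (F w ^+ 2 + (- 2 * c) * F w) + c ^+ 2) z.
  apply: sign_avg_ge0 => w.
  by have := sqr_ge0 (F w - c); rewrite sqrrB; lra.
by rewrite sign_avgD sign_avgD sign_avgZ sign_avg_cst -/c; lra.
Qed.

(** Opposite signs cancel the cross terms, one vector at a time. This computes second moments both
    for [sqmod] on scalars and for [hsq] on vectors. *)
Lemma sign_avg_parallelogram (q : V -> R) s z :
  (forall w v, q (w + v) + q (w - v) = 2 * (q w + q v)) ->
  sign_avg s q z = q z + \sum_(v <- s) q v.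
Proof.
move=> qP; elim: s z => [|v s IH] z /=; first by rewrite big_nil addr0.
by rewrite !IH big_cons; have := qP z v; lra.
Qed.

End SignAverage.

Lemma sign_avg_map (R : realType) (V W : zmodType) (f : {additive V -> W})
    (s : seq V) (F : W -> R) (z : V) :
  sign_avg s (fun w => F (f w)) z = sign_avg (map f s) F (f z).
Proof. by elim: s z => [|v s IH] z //=; rewrite !IH raddfD raddfB. Qed.

(** * Khinchine's inequality for complex scalars *)

Section Khinchine.
Variable R : realType.

(** The squared modulus as an element of [R], whereas the norm on [R[i]] is [R[i]]-valued. *)
Definition sqmod (z : R[i]) : R := complex.Re z ^+ 2 + complex.Im z ^+ 2.

Lemma sqmod_ge0 z : 0 <= sqmod z.
Proof. by rewrite addr_ge0// sqr_ge0. Qed.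

Lemma sqmodE z : (sqmod z)%:C = `|z| ^+ 2.
Proof. by rewrite normc_def -rmorphXn sqr_sqrtr ?addr_ge0 ?sqr_ge0. Qed.

Lemma sqmodM (z1 z2 : R[i]) : sqmod (z1 * z2) = sqmod z1 * sqmod z2.
Proof. by apply: complexI; rewrite rmorphM /= !sqmodE normrM exprMn. Qed.

Lemma sqmod_real (r : R) : sqmod r%:C = r ^+ 2.
Proof. by rewrite /sqmod /= expr0n addr0. Qed.

Lemma sqmod_parallelogram w v :
  sqmod (w + v) + sqmod (w - v) = 2 * (sqmod w + sqmod v).
Proof. by case: w v => [a b] [c d]; rewrite /sqmod /=; ring. Qed.

(** The only loss is Cauchy-Schwarz for the real part of [w] times the conjugate of [v]; the defect
    is 8 times the square of the imaginary part. *)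
Lemma sqmod_fourth w v :
  sqmod (w + v) ^+ 2 + sqmod (w - v) ^+ 2 <=
  2 * (sqmod w ^+ 2 + 6 * (sqmod w * sqmod v) + sqmod v ^+ 2).
Proof.
case: w v => [a b] [c d]; rewrite /sqmod /= -subr_ge0.
set X := (X in 0 <= X); suff -> : X = 8 * (a * d - b * c) ^+ 2.
  by rewrite mulr_ge0// sqr_ge0.
by rewrite /X; ring.
Qed.

(** The centre [z] is arbitrary so that induction on the list can shift it to [z + v] and [z - v];
    only [z = 0] is used afterwards. *)
Lemma sign_avg_fourth (s : seq R[i]) (z : R[i]) :
  sign_avg s (fun w => sqmod w ^+ 2) z <=
  sqmod z ^+ 2 + 6 * (sqmod z * \sum_(v <- s) sqmod v)
    + 3 * (\sum_(v <- s) sqmod v) ^+ 2.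
Proof.
elim: s z => [|v s IH] z /=; first by rewrite big_nil expr0n /=; lra.
have := IH (z + v); have := IH (z - v); rewrite big_cons.
set S := \sum_(v <- s) sqmod v.
have := sqmod_fourth z v; have := sqmod_parallelogram z v.
have := sqmod_ge0 v.
set h := sqmod v; set g := sqmod z.
set gp := sqmod (z + v); set gm := sqmod (z - v) => h0 e1 e4.
have -> : gm = 2 * (g + h) - gp by lra.
have : 0 <= h ^+ 2 by exact: sqr_ge0.
by move: e4; rewrite (_ : gm = 2 * (g + h) - gp); [nra|lra].
Qed.

(* The fourth moment of a Rademacher sum is at most three times the square of
   its second moment; averaging [t >= t^2 / sg - t^4 / (6 sg^3)] over the signs
   therefore bounds the first moment below by [sg / 2]. *)
Lemma khinchine (s : seq R[i]) :
  sqrtr (\sum_(v <- s) sqmod v) <= 2 * sign_avg s (fun w => sqrtr (sqmod w)) 0.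
Proof.
set S := \sum_(v <- s) sqmod v.
have S0 : 0 <= S by rewrite sumr_ge0// => v _; exact: sqmod_ge0.
set sg := sqrtr S; have sgS : S = sg ^+ 2 by rewrite sqr_sqrtr.
have sg0 : 0 <= sg := sqrtr_ge0 _.
have E0 : 0 <= sign_avg s (fun w => sqrtr (sqmod w)) 0.
  by apply: sign_avg_ge0 => w; exact: sqrtr_ge0.
have [sgE|sg1] := eqVneq sg 0; first by rewrite sgE mulr_ge0.
have {sg1}sg0 : 0 < sg by rewrite lt_neqAle eq_sym sg1.
have := sign_avg_fourth s 0; have := sign_avg_parallelogram s 0 sqmod_parallelogram.
rewrite -/S (_ : sqmod 0 = 0); last by rewrite /sqmod /= expr0n addr0.
rewrite add0r expr0n mul0r mulr0 !add0r => E2 E4.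
have : sign_avg s (fun w => sg ^+ 2 * sqmod w + (- (1 / 6)) * sqmod w ^+ 2) 0
   <= sign_avg s (fun w => sg ^+ 3 * sqrtr (sqmod w)) 0.
  apply: sign_avg_le => w; set t := sqrtr _.
  have -> : sqmod w = t ^+ 2 by rewrite sqr_sqrtr// sqmod_ge0.
  have t0 : 0 <= t := sqrtr_ge0 _.
  (* The product expands to [4 t^4 - 27 sg^2 t^2 + 27 sg^3 t], which is the wanted bound with 4/27
     for 1/6. The weaker 1/6 combines with the fourth moment [3 sg^4] to leave exactly 1/2. *)
  have : 0 <= t * ((2 * t - 3 * sg) ^+ 2 * (t + 3 * sg)).
    by rewrite mulr_ge0// mulr_ge0 ?sqr_ge0// addr_ge0// mulr_ge0// ltW.
  have : 0 <= t ^+ 4 by rewrite exprn_ge0.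
  by lra.
rewrite sign_avgD !sign_avgZ E2 sgS => E1.
have : sg ^+ 3 * sg <= sg ^+ 3 * (2 * sign_avg s (fun w => sqrtr (sqmod w)) 0).
  by move: E4; rewrite sgS; lra.
by rewrite ler_pM2l// exprn_gt0.
Qed.

End Khinchine.

(** * From unconditionality to a vector-valued inequality *)

Section Hilbert.
Variables (R : realType) (H : vectType R[i]) (dot : {dot H for conjC}).
Implicit Types u v w : H.

Definition cmod (z : R[i]) : R := sqrtr (sqmod z).

Definition hsq u : R := complex.Re (dot u u).

Definition hlen u : R := sqrtr (hsq u).

Lemma cmodE z : (cmod z)%:C = `|z|.
Proof. by rewrite normc_def. Qed.

Lemma cmodM z1 z2 : cmod (z1 * z2) = cmod z1 * cmod z2.
Proof. by apply: complexI; rewrite rmorphM /= !cmodE normrM. Qed.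

Lemma hsqE u : (hsq u)%:C = dot u u.
Proof. by apply/RRe_real/ger0_real/dnorm_ge0. Qed.

Lemma hsq_ge0 u : 0 <= hsq u.
Proof. by rewrite -lecR hsqE dnorm_ge0. Qed.

Lemma hlen_ge0 u : 0 <= hlen u.
Proof. exact: sqrtr_ge0. Qed.

Lemma hnormE u : hnorm dot u = (hlen u)%:C.
Proof.
rewrite /hnorm -hsqE -[hsq u](@sqr_sqrtr R) ?hsq_ge0// rmorphXn /=.
by rewrite sqrCK// lecR hlen_ge0.
Qed.

Lemma hsqZ (a : R[i]) u : hsq (a *: u) = sqmod a * hsq u.
Proof. by apply: complexI; rewrite rmorphM /= sqmodE !hsqE dnormZ. Qed.

Lemma hsq_parallelogram u v : hsq (u + v) + hsq (u - v) = 2 * (hsq u + hsq v).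
Proof.
apply: complexI; rewrite rmorphM !rmorphD /= !hsqE dnormD dnormB.
by ring.
Qed.

Lemma cmod_dot_le u v : cmod (dot u v) <= hlen u * hlen v.
Proof.
rewrite -lecR rmorphM /= cmodE -!hnormE.
exact: (CauchySchwarz_sqrt dot u v).
Qed.

Variables (n : nat) (C : R) (x y : 'I_n -> H).
Hypothesis C0 : 0 < C.
Hypothesis xyC : forall (u : H) (eps : 'I_n -> R[i]),
  (forall k, `|eps k| <= 1) ->
  hnorm dot (\sum_(k < n) (eps k * dot u (y k)) *: x k) <= C%:C * hnorm dot u.

Lemma unconditional_sum_le u v :
  \sum_k cmod (dot u (y k)) * cmod (dot v (x k)) <= C * (hlen u * hlen v).
Proof.
pose c k := dot u (y k) * dot (x k) v.
have cE k : cmod (dot u (y k)) * cmod (dot v (x k)) = cmod (c k).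
  rewrite cmodM; congr (_ * _); apply: complexI; rewrite !cmodE.
  by rewrite (hermC dot) expr0 mul1r norm_conjC.
(* The conjugate phase of [c k]; where [c k = 0] the division yields 0, which still has modulus at
   most 1. *)
pose eps k : R[i] := (c k)^* / `|c k|.
have eps1 k : `|eps k| <= 1.
  rewrite /eps normrM normfV norm_conjC normr_id.
  by have [->|c0] := eqVneq (c k) 0; rewrite ?normr0 ?mul0r// divff ?normr_eq0.
have epsc k : eps k * c k = `|c k|.
  have [->|c0] := eqVneq (c k) 0; first by rewrite mulr0 normr0.
  by rewrite /eps mulrAC [_^* * _]mulrC -normCK expr2 mulfK ?normr_eq0.
set w := \sum_(k < n) (eps k * dot u (y k)) *: x k.
have wv : dot w v = (\sum_k cmod (c k))%:C.
  rewrite linear_sumlz rmorph_sum /=; apply: eq_bigr => k _.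
  by rewrite linearZl_LR /= -mulrA epsc cmodE.
under eq_bigr do rewrite cE.
rewrite -lecR -wv; apply: le_trans (real_ler_norm _) _.
  by rewrite wv; apply/complex_realP; eexists.
rewrite -cmodE lecR (le_trans (cmod_dot_le _ _))// mulrA.
rewrite ler_wpM2r ?hlen_ge0//.
by have := xyC u eps1; rewrite -/w !hnormE -rmorphM lecR.
Qed.

Lemma unconditional_square_sum_le (s t : seq H) :
  \sum_k sqrtr (\sum_(u <- s) sqmod (dot u (y k)))
       * sqrtr (\sum_(v <- t) sqmod (dot v (x k)))
  <= 4 * C * (sqrtr (\sum_(u <- s) hsq u) * sqrtr (\sum_(v <- t) hsq v)).
Proof.
have kh (r : seq H) w : sqrtr (\sum_(u <- r) sqmod (dot u w))
    <= 2 * sign_avg r (fun u => cmod (dot u w)) 0.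
  have := khinchine (map (applyr dot w) r); rewrite big_map /=.
  move=> /le_trans; apply; rewrite -[0 in leLHS](raddf0 (applyr dot w)).
  by rewrite -(sign_avg_map (applyr dot w) r (fun z => sqrtr (sqmod z))).
have len (r : seq H) : sign_avg r hlen 0 <= sqrtr (\sum_(u <- r) hsq u).
  rewrite -[leLHS]ger0_norm; last by apply: sign_avg_ge0 => w; exact: hlen_ge0.
  rewrite -sqrtr_sqr ler_sqrt ?sumr_ge0// => [|u _]; last exact: hsq_ge0.
  apply: le_trans (sign_avg_jensen _ _ _) _.
  rewrite (@eq_sign_avg _ _ _ _ hsq); last by move=> w; rewrite sqr_sqrtr ?hsq_ge0.
  rewrite (sign_avg_parallelogram _ _ hsq_parallelogram).
  by rewrite /hsq linear0l /= add0r.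
have avg0 (r : seq H) w : 0 <= sign_avg r (fun u => cmod (dot u w)) 0.
  by apply: sign_avg_ge0 => ?; exact: sqrtr_ge0.
have lavg0 (r : seq H) : 0 <= sign_avg r hlen 0.
  by apply: sign_avg_ge0 => ?; exact: sqrtr_ge0.
(* The 4 is one Khinchine factor 2 for each of the two square roots. *)
apply: (@le_trans _ _ (4 * \sum_k sign_avg s (fun u => cmod (dot u (y k))) 0
    * sign_avg t (fun v => cmod (dot v (x k))) 0)).
  rewrite mulr_sumr; apply: ler_sum => k _.
  have := ler_pM (sqrtr_ge0 _) (sqrtr_ge0 _) (kh s (y k)) (kh t (x k)).
  by move=> /le_trans; apply; rewrite mulrACA -natrM.
rewrite -mulrA ler_pM2l//.
apply: (@le_trans _ _ (C * (sign_avg s hlen 0 * sign_avg t hlen 0))); last first.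
  by rewrite ler_pM2l// ler_pM.
(* The product of averages is a double average over independent signs, so [unconditional_sum_le] can
   be applied pointwise. *)
under eq_bigr do rewrite mulrC -sign_avgZ.
rewrite -sign_avg_sum mulrA mulrAC -sign_avgZ; apply: sign_avg_le => u.
under eq_bigr do rewrite mulrC -sign_avgZ.
rewrite -sign_avg_sum mulrAC -sign_avgZ; apply: sign_avg_le => v.
by rewrite -mulrA; exact: unconditional_sum_le.
Qed.

(** Rescaling [u i] by the square root of its weight reduces this to the unweighted case. One family
    of test vectors thus carries two weight systems, as the balancing argument requires. *)
Lemma unconditional_weighted_sum_le (m : nat) (u : 'I_m -> H) (la mu : 'I_m -> R) :
  (forall i, 0 <= la i) -> (forall i, 0 <= mu i) ->
  \sum_k sqrtr (\sum_i la i * sqmod (dot (u i) (y k)))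
       * sqrtr (\sum_i mu i * sqmod (dot (u i) (x k)))
  <= 4 * C * (sqrtr (\sum_i la i * hsq (u i)) * sqrtr (\sum_i mu i * hsq (u i))).
Proof.
pose s (nu : 'I_m -> R) := [seq (sqrtr (nu i))%:C *: u i | i <- enum 'I_m].
have s1 nu w : (forall i, 0 <= nu i) ->
    \sum_(v <- s nu) sqmod (dot v w) = \sum_i nu i * sqmod (dot (u i) w).
  move=> nu0; rewrite big_map big_enum; apply: eq_bigr => i _.
  by rewrite linearZl_LR /= sqmodM sqmod_real sqr_sqrtr.
have s2 nu : (forall i, 0 <= nu i) ->
    \sum_(v <- s nu) hsq v = \sum_i nu i * hsq (u i).
  move=> nu0; rewrite big_map big_enum; apply: eq_bigr => i _.
  by rewrite hsqZ sqmod_real sqr_sqrtr.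
move=> la0 mu0; have := unconditional_square_sum_le (s la) (s mu).
by rewrite !s2//; under eq_bigr do rewrite !s1//.
Qed.

End Hilbert.

(** * Exponential sums and compactness *)

Section ExpSum.
Variable R : realType.

Lemma box_compact n (L : R) :
  compact [set s : 'rV[R]_n | forall k, `|s ord0 k| <= L]%classic.
Proof.
rewrite (_ : [set s | _]%classic =
    [set s : 'rV[R]_n | forall k, (`[- L, L]%classic) (s ord0 k)]%classic).
  by apply: (@rV_compact R n (fun=> `[- L, L]%classic)) => k; exact: segment_compact.
by apply/seteqP; split=> s /= sL k; have := sL k; rewrite in_itv /= ler_norml.
Qed.

(** With [a k] the squared modulus of a coefficient, this is the Bessel sum after scaling the [k]-th
    vector by [exp(sg s_k / 2)]: [sg = 1] serves the [x k] and [sg = - 1] the [y k]. *)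
Definition expsum n (sg : R) (a : 'I_n -> R) (s : 'rV[R]_n) : R :=
  \sum_k expR (sg * s ord0 k) * a k.

Lemma expsum_continuous n (sg : R) (a : 'I_n -> R) : continuous (expsum sg a).
Proof.
apply: (continuous_big add_continuous) => k _ s.
have sg_cont : {for s, continuous (fun t : 'rV[R]_n => sg * t ord0 k)}.
  exact: (cvgMl_tmp (@coord_continuous R 1 n ord0 k s)).
have exp_cont := continuous_comp sg_cont (@continuous_expR R _).
exact: (cvgMr_tmp (b := a k) exp_cont).
Qed.

(** The [k]-th term alone is at most [B], and [exp z >= z]; the two signs bound the coordinate from
    above and from below. *)
Lemma coord_le_expsum n (a b : 'I_n -> R) (s : 'rV[R]_n) k (eta B : R) :
  (forall j, 0 < a j) -> (forall j, 0 < b j) ->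
  0 < eta -> eta <= a k -> eta <= b k ->
  expsum 1 a s <= B -> expsum (- 1) b s <= B -> `|s ord0 k| <= B / eta.
Proof.
move=> a0 b0 eta0 ae be upB dnB.
have h (sg : R) (c : 'I_n -> R) : (forall j, 0 < c j) -> eta <= c k ->
    expsum sg c s <= B -> sg * s ord0 k <= B / eta.
  move=> c0 ce cB; rewrite ler_pdivlMr//.
  apply: le_trans cB; rewrite /expsum (bigD1 k)//=.
  set z := sg * s ord0 k; apply: (@le_trans _ _ (expR z * c k)).
    apply: (@le_trans _ _ (expR z * eta)).
      by rewrite ler_wpM2r ?ltW//; have := expR_ge1Dx z; lra.
    by rewrite ler_wpM2l// expR_ge0.
  by rewrite lerDl sumr_ge0// => j _; rewrite mulr_ge0 ?expR_ge0// ltW.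
rewrite ler_norml; have := h 1 a a0 ae upB.
by have := h (- 1) b b0 be dnB; lra.
Qed.

(** Since [eta] is uniform in [i], all the closed solution sets lie in one compact box, and the
    finite intersection property applies. *)
Lemma expsum_compactness n (I : choiceType) (a b : I -> 'I_n -> R) (eta B : R) :
  0 < eta -> (forall i k, eta <= a i k) -> (forall i k, eta <= b i k) ->
  (forall m (f : 'I_m -> I), (0 < m)%N -> exists s : 'rV[R]_n,
     forall j, expsum 1 (a (f j)) s <= B /\ expsum (- 1) (b (f j)) s <= B) ->
  exists s : 'rV[R]_n,
    forall i, expsum 1 (a i) s <= B /\ expsum (- 1) (b i) s <= B.
Proof.
move=> eta0 ae be fin.
pose g i := [set s : 'rV[R]_n |
  expsum 1 (a i) s <= B /\ expsum (- 1) (b i) s <= B]%classic.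
have g_closed i : closed (g i).
  rewrite (_ : g i = (expsum 1 (a i) @^-1` [set z | z <= B]
     `&` expsum (- 1) (b i) @^-1` [set z | z <= B])%classic)//.
  by apply: closedI; apply: closed_comp (@closed_le _ B) => s _;
    exact: expsum_continuous.
pose box := [set s : 'rV[R]_n | forall k, `|s ord0 k| <= B / eta]%classic.
have g_box i : (g i `<=` box)%classic.
  move=> s [up dn] k; apply: (coord_le_expsum _ _ eta0 (ae i k) (be i k) up dn).
    by move=> j; exact: lt_le_trans eta0 _.
  by move=> j; exact: lt_le_trans eta0 _.
have := @box_compact n (B / eta); rewrite -/box compact_In0.
move=> /(_ I setT (fun i => box `&` g i)%classic).
case.
- by exists g.
- move=> D' _; case: (fset_0Vmem D') => [->|[i0 _]].
    by exists 0.
  (* Putting [i0] in front makes the length positive by computation. *)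
  have [] := fin (size (i0 :: D')) (fun j => nth i0 (i0 :: D') j) isT => s sP.
  have inD i : i \in i0 :: D' -> g i s.
    move=> iD; have jlt : (index i (i0 :: D') < size (i0 :: D'))%N by rewrite index_mem.
    by have := sP (Ordinal jlt); rewrite /= nth_index.
  exists s => i /= iD; have gi := inD i; rewrite inE iD orbT in gi.
  by split; [apply: (g_box i)|]; exact: gi.
- by move=> s sP; exists s => i; have [] := sP i Logic.I.
Qed.

End ExpSum.

(** * Minimising the power-sum potential *)

Section Balancing.
Variable R : realType.
Variables (m n : nat) (a b : 'I_m -> 'I_n -> R).
Hypotheses (a0 : forall i k, 0 < a i k) (b0 : forall i k, 0 < b i k).

Definition row_up (s : 'rV[R]_n) i : R := expsum 1 (a i) s.
Definition row_dn (s : 'rV[R]_n) i : R := expsum (- 1) (b i) s.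
Definition pot p s : R := \sum_i (row_up s i ^+ p + row_dn s i ^+ p).

Lemma row_up_ge0 s i : 0 <= row_up s i.
Proof. by apply: sumr_ge0 => k _; rewrite mulr_ge0 ?expR_ge0// ltW. Qed.

Lemma row_dn_ge0 s i : 0 <= row_dn s i.
Proof. by apply: sumr_ge0 => k _; rewrite mulr_ge0 ?expR_ge0// ltW. Qed.

Lemma pot_continuous p : continuous (pot p).
Proof.
apply: (continuous_big add_continuous) => i _ s.
have up_cont := continuous_comp (@expsum_continuous R _ 1 (a i) s)
  (@exprn_continuous R p _).
have dn_cont := continuous_comp (@expsum_continuous R _ (- 1) (b i) s)
  (@exprn_continuous R p _).
exact: (cvgD up_cont dn_cont).
Qed.

(** This serves only to confine sublevel sets of [pot], so the crude [z <= 1 + z ^+ p] replaces a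
    [p]-th root. *)
Lemma row_le_pot p s i : (0 < p)%N ->
  row_up s i <= 1 + pot p s /\ row_dn s i <= 1 + pot p s.
Proof.
move=> p0.
have le1 (z : R) : 0 <= z -> z <= 1 + z ^+ p.
  move=> z0; have [z1|z1] := leP z 1.
    by rewrite (le_trans z1)// lerDl exprn_ge0.
  by rewrite ler_wpDl// ler_eXnr// ltW.
have ge0 j : 0 <= row_up s j ^+ p + row_dn s j ^+ p.
  by apply: addr_ge0; apply: exprn_ge0; [exact: row_up_ge0|exact: row_dn_ge0].
have : row_up s i ^+ p + row_dn s i ^+ p <= pot p s.
  by rewrite /pot (bigD1 i)//= lerDl sumr_ge0.
have := le1 _ (row_up_ge0 s i); have := le1 _ (row_dn_ge0 s i).
have := exprn_ge0 p (row_up_ge0 s i); have := exprn_ge0 p (row_dn_ge0 s i).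
by move=> *; split; lra.
Qed.

(** A single row [i0] already confines the sublevel set of [pot p 0] to a box. The minimum over that
    box is global, because outside it the potential exceeds its value at 0. *)
Lemma pot_min p : (0 < p)%N -> (0 < m)%N ->
  exists s, forall t, pot p s <= pot p t.
Proof.
move=> p0 m0; pose i0 := Ordinal m0; pose B := 1 + pot p 0.
have B0 : 0 <= B by rewrite (le_trans (row_up_ge0 0 i0))// (row_le_pot 0 i0 p0).1.
pose eta k := Order.min (a i0 k) (b i0 k).
have eta0 k : 0 < eta k by rewrite lt_min a0 b0.
pose L := \sum_k B / eta k.
have in_box t : pot p t <= pot p 0 -> forall k, `|t ord0 k| <= L.
  move=> tle k; have [up dn] := row_le_pot t i0 p0.
  apply: (@le_trans _ _ (B / eta k)).
    apply: (@coord_le_expsum R n (a i0) (b i0)) => //.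
    - by rewrite ge_min lexx.
    - by rewrite ge_min lexx orbT.
    - by rewrite (le_trans up)// lerD2l.
    - by rewrite (le_trans dn)// lerD2l.
  by rewrite /L (bigD1 k)//= lerDl sumr_ge0// => j _; rewrite divr_ge0// ltW.
have box0 : ([set s : 'rV[R]_n | forall k, `|s ord0 k| <= L] !=set0)%classic.
  by exists 0 => k; exact: in_box.
have [s sbox smin] := compact_EVT_min box0 (@box_compact R n L)
    (continuous_subspaceT (@pot_continuous p)).
exists s => t; have [t0|/ltW] := leP (pot p t) (pot p 0).
    by apply: smin; rewrite inE => k; exact: in_box.
  by apply: le_trans; apply: smin; rewrite inE => k; exact: in_box.
Qed.

(** When one coordinate of [s] moves by [t], every row sum takes the form
    [al + expR (sg * t) * c]. *)
Lemma is_derive_affine_expX p (al sg c x : R) :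
  is_derive (x : R) (1 : R) (fun t : R => (al + expR (sg * t) * c) ^+ p)
    (p%:R * (al + expR (sg * x) * c) ^+ p.-1 * (sg * (expR (sg * x) * c))).
Proof.
have lin := is_deriveZ sg (is_derive_id (x : R) (1 : R)).
have ex := is_derive1_comp (is_derive_expR (sg *: (x : R))) lin.
have aff := is_deriveD (is_derive_cst al (x : R) (1 : R)) (is_deriveZ c ex).
have -> : (fun t : R => (al + expR (sg * t) * c) ^+ p) =
    (cst al + c \*: (expR \o (sg \*: id))) ^+ p.
  by apply/funext => t; rewrite fctE /= mulrC.
apply: (is_derive_eq (is_deriveX p aff)).
rewrite add0r /cst /= fctE /= /GRing.scale /=.
by rewrite [expR _ * c]mulrC; congr (_ * _); ring.
Qed.

(** The partial derivative in [s_k] vanishes at a minimum; the common factor [p] is cancelled. *)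
Lemma pot_critical p s : (0 < p)%N -> (forall t, pot p s <= pot p t) ->
  forall k, \sum_i row_up s i ^+ p.-1 * (expR (s ord0 k) * a i k) =
            \sum_i row_dn s i ^+ p.-1 * (expR (- s ord0 k) * b i k).
Proof.
move=> p0 smin k.
pose sk t : 'rV[R]_n := \row_j (s ord0 j + (if j == k then t else 0)).
pose al i := row_up s i - expR (s ord0 k) * a i k.
pose be i := row_dn s i - expR (- s ord0 k) * b i k.
have skE (sg t : R) (c : 'I_n -> R) :
    expsum sg c (sk t) = (expsum sg c s - expR (sg * s ord0 k) * c k)
    + expR (sg * t) * (expR (sg * s ord0 k) * c k).
  rewrite /expsum (bigD1 k)//= [in RHS](bigD1 k)//= mxE eqxx mulrDr expRD.
  rewrite (eq_bigr (fun j => expR (sg * s ord0 j) * c j)) => [|j jk]; first by ring.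
  by rewrite mxE (negbTE jk) addr0.
pose g (i : 'I_m) (t : R) := (al i + expR (1 * t) * (expR (s ord0 k) * a i k)) ^+ p
   + (be i + expR (- 1 * t) * (expR (- s ord0 k) * b i k)) ^+ p.
have upE i t : row_up (sk t) i = al i + expR (1 * t) * (expR (s ord0 k) * a i k).
  by have := skE 1 t (a i); rewrite [1 * s ord0 k]mul1r; exact.
have dnE i t :
    row_dn (sk t) i = be i + expR (- 1 * t) * (expR (- s ord0 k) * b i k).
  by have := skE (- 1) t (b i); rewrite [- 1 * s ord0 k]mulN1r; exact.
have gE : pot p \o sk = \sum_i g i.
  apply/funext => t; rewrite fct_sumE; apply: eq_bigr => i _.
  by rewrite upE dnE.
pose X i t := al i + expR (1 * t) * (expR (s ord0 k) * a i k).
pose Y i t := be i + expR (- 1 * t) * (expR (- s ord0 k) * b i k).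
pose dg i t := p%:R * X i t ^+ p.-1 * (1 * (expR (1 * t) * (expR (s ord0 k) * a i k)))
  + p%:R * Y i t ^+ p.-1 * (- 1 * (expR (- 1 * t) * (expR (- s ord0 k) * b i k))).
have g'E i t : is_derive (t : R) (1 : R) (g i) (dg i t).
  exact: (is_deriveD (is_derive_affine_expX p (al i) 1 _ t)
     (is_derive_affine_expX p (be i) (- 1) _ t)).
have pot' (t : R) : is_derive t (1 : R) (pot p \o sk) (\sum_i dg i t).
  by rewrite gE; apply: is_derive_sum.
have sk0 : sk 0 = s by apply/rowP => j; rewrite mxE if_same addr0.
have pot'0 : is_derive (0 : R) (1 : R) (pot p \o sk) 0.
  apply: (@derive1_at_min _ _ (- 1) 1) => //.
  - by lra.
  - by rewrite in_itv /= ltrN10 ltr01.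
  - by move=> t _; rewrite /= sk0.
have : \sum_i dg i 0 = 0.
  by have := @derive_val _ _ _ _ _ _ _ pot'0; rewrite (@derive_val _ _ _ _ _ _ _ (pot' 0)).
rewrite /dg; under eq_bigr => i _.
  rewrite /X /Y !mulr0 expR0 !mul1r /al /be !subrK mulN1r mulrN -!mulrA -mulrBr.
  over.
rewrite -mulr_sumr => /eqP; rewrite mulf_eq0 pnatr_eq0 eqn0Ngt p0 /=.
by rewrite sumrB subr_eq0 => /eqP.
Qed.

(* At a minimum of [pot m], with [A_i], [B_i] the row sums, the condition
   [pot_critical] gives [sum A_i^m = sum B_i^m <=
   c sqrt(sum A_i^(m-1)) sqrt(sum B_i^(m-1))]. Since
   [z^(m-1) <= z^m / (2c) + (2c)^(m-1)], both sums are at most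
   [m (2c)^m <= (4c)^m]; the exponent [m] is only chosen for [m <= 2^m]. *)
Lemma balancing (c : R) : (0 < m)%N -> 0 < c ->
  (forall la mu : 'I_m -> R, (forall i, 0 <= la i) -> (forall i, 0 <= mu i) ->
    \sum_k sqrtr (\sum_i la i * a i k) * sqrtr (\sum_i mu i * b i k)
      <= c * (sqrtr (\sum_i la i) * sqrtr (\sum_i mu i))) ->
  exists s, forall i, row_up s i <= 4 * c /\ row_dn s i <= 4 * c.
Proof.
move=> m0 c0 abc.
have [s smin] := pot_min m0 m0; exists s.
have crit := pot_critical m0 smin.
pose up i := row_up s i ^+ m.-1; pose dn i := row_dn s i ^+ m.-1.
have up0 i : 0 <= up i by apply: exprn_ge0; exact: row_up_ge0.
have dn0 i : 0 <= dn i by apply: exprn_ge0; exact: row_dn_ge0.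
pose U := \sum_i row_up s i ^+ m; pose D := \sum_i row_dn s i ^+ m.
pose P k := \sum_i up i * a i k; pose Q k := \sum_i dn i * b i k.
have P0 k : 0 <= P k by apply: sumr_ge0 => i _; rewrite mulr_ge0// ltW.
have Q0 k : 0 <= Q k by apply: sumr_ge0 => i _; rewrite mulr_ge0// ltW.
have PQ k : expR (s ord0 k) * P k = expR (- s ord0 k) * Q k.
  rewrite /P /Q !mulr_sumr; have := crit k; rewrite -/up -/dn.
  by under eq_bigr do rewrite mulrCA; under [in RHS]eq_bigr do rewrite mulrCA.
have UE : U = \sum_k expR (s ord0 k) * P k.
  under [RHS]eq_bigr do rewrite mulr_sumr.
  rewrite exchange_big; apply: eq_bigr => i _ /=.
  rewrite -(prednK m0) exprSr [X in _ * X]/row_up /expsum mulr_sumr.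
  apply: eq_bigr => k _.
  by rewrite mul1r mulrCA.
have DE : D = \sum_k expR (- s ord0 k) * Q k.
  under [RHS]eq_bigr do rewrite mulr_sumr.
  rewrite exchange_big; apply: eq_bigr => i _ /=.
  rewrite -(prednK m0) exprSr [X in _ * X]/row_dn /expsum mulr_sumr.
  apply: eq_bigr => k _.
  by rewrite mulN1r mulrCA.
have UD : U = D by rewrite UE DE; apply: eq_bigr => k _; exact: PQ.
(* By [PQ] both weighted quantities coincide, hence equal their geometric mean, in which the
   exponentials cancel. This brings [U] into the form bounded by [abc]. *)
have sqrtPQ k : expR (s ord0 k) * P k = sqrtr (P k) * sqrtr (Q k).
  have wP0 : 0 <= expR (s ord0 k) * P k by rewrite mulr_ge0// expR_ge0.
  rewrite -sqrtrM// -[LHS]ger0_norm// -sqrtr_sqr expr2 {2}PQ.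
  by rewrite mulrACA -expRD subrr expR0 mul1r.
have pow_le z : 0 <= z -> z ^+ m.-1 <= z ^+ m / (2 * c) + (2 * c) ^+ m.-1.
  move=> z0; have c2 : 0 < 2 * c by rewrite mulr_gt0.
  have [zc|/ltW cz] := leP z (2 * c).
    apply: ler_wpDl; first by rewrite divr_ge0 ?exprn_ge0// ltW.
    by rewrite lerXn2r// nnegrE ltW.
  apply: ler_wpDr; first by rewrite exprn_ge0// ltW.
  rewrite ler_pdivlMr// -[in leRHS](prednK m0) exprSr.
  by rewrite ler_wpM2l// exprn_ge0.
pose T := U / (2 * c) + m%:R * (2 * c) ^+ m.-1.
have sum_le (r : 'I_m -> R) : (forall i, 0 <= r i) ->
    \sum_i r i ^+ m.-1 <= (\sum_i r i ^+ m) / (2 * c) + m%:R * (2 * c) ^+ m.-1.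
  move=> r0; have -> : m%:R * (2 * c) ^+ m.-1 = \sum_(i < m) (2 * c) ^+ m.-1.
    by rewrite sumr_const card_ord mulr_natl.
  by rewrite mulr_suml -big_split; apply: ler_sum => i _; exact: pow_le.
have upT : \sum_i up i <= T by apply: sum_le => i; exact: row_up_ge0.
have dnT : \sum_i dn i <= T.
  by rewrite /T UD; apply: sum_le => i; exact: row_dn_ge0.
have T0 : 0 <= T by apply: le_trans upT; exact: sumr_ge0.
have UcT : U <= c * T.
  rewrite UE; under eq_bigr do rewrite sqrtPQ.
  apply: le_trans (abc _ _ up0 dn0) _; rewrite ler_pM2l//.
  apply: (@le_trans _ _ (sqrtr T * sqrtr T)); last by rewrite -expr2 sqr_sqrtr.
  by apply: ler_pM; rewrite ?sqrtr_ge0// ler_sqrt.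
have Uc : U <= (4 * c) ^+ m.
  apply: (@le_trans _ _ (m%:R * (2 * c) ^+ m)).
    (* By the choice of [T], [2cT] is [U] plus [m (2c)^m], so [U <= cT] lets [U] be absorbed. *)
    have -> : m%:R * (2 * c) ^+ m = 2 * (c * T) - U.
      have -> : (2 * c) ^+ m = (2 * c) ^+ m.-1 * (2 * c).
        by rewrite -exprSr prednK.
      by rewrite /T; field; rewrite gt_eqF.
    by lra.
  have -> : 4 * c = 2 * (2 * c) by ring.
  rewrite [leRHS]exprMn; apply: ler_wpM2r.
    by rewrite exprn_ge0// mulr_ge0// ltW.
  by rewrite -natrX ler_nat ltnW// ltn_expl.
have root_le (r : 'I_m -> R) i : (forall j, 0 <= r j) ->
    \sum_j r j ^+ m <= (4 * c) ^+ m -> r i <= 4 * c.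
  move=> r0 rc; have c4 : 0 <= 4 * c by rewrite mulr_ge0// ltW.
  rewrite -(ler_pXn2r m0) ?nnegrE//.
  apply: le_trans rc; rewrite (bigD1 i)//= lerDl sumr_ge0// => j _.
  exact: exprn_ge0.
move=> i; split; apply: root_le => //.
- by move=> j; exact: row_up_ge0.
- by move=> j; exact: row_dn_ge0.
- by rewrite -/D -UD.
Qed.

End Balancing.

(** * Bessel bounds from exponential sums *)

Section Bessel.
Variables (R : realType) (H : vectType R[i]) (dot : {dot H for conjC}).

(* The zero vector is normalised to itself, since [0^-1 = 0]. *)
Definition normalize (u : H) : H := (hlen dot u)^-1%:C *: u.

Lemma normalizeK u : (hlen dot u)%:C *: normalize u = u.
Proof.
rewrite scalerA -rmorphM /=; have [u0|u0] := eqVneq (hlen dot u) 0; last first.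
  by rewrite mulfV// scale1r.
rewrite u0 mul0r scale0r; apply/esym/eqP; rewrite -(dnorm_eq0 dot) -hsqE.
move/eqP: u0; rewrite sqrtr_eq0 => u0.
by rewrite (_ : hsq dot u = 0)//; apply/le_anti; rewrite u0 hsq_ge0.
Qed.

Lemma hsq_normalize_le1 u : hsq dot (normalize u) <= 1.
Proof.
rewrite hsqZ sqmod_real -(@sqr_sqrtr R (hsq dot u)) ?hsq_ge0// -exprMn.
by have [->|u0] := eqVneq (hlen dot u) 0;
  rewrite ?invr0 ?mul0r ?expr0n ?ler01// -/(hlen dot u) mulVf// expr1n.
Qed.

Lemma sqmod_dot_le u v : sqmod (dot u v) <= hsq dot u * hsq dot v.
Proof.
have := cmod_dot_le dot u v; rewrite -sqrtrM ?hsq_ge0// ler_sqrt//.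
by rewrite mulr_ge0// hsq_ge0.
Qed.

(** Homogeneity reduces the bound to normalised vectors. The exponent is halved because the
    multiplier enters squared, and adding [eta] only enlarges the sum. *)
Lemma Bessel_expsum n (z : 'I_n -> H) (sg eta B : R) (s : 'rV[R]_n) :
  0 <= eta ->
  (forall u,
     expsum sg (fun k => sqmod (dot (normalize u) (z k)) + eta) s <= B) ->
  Bessel dot B (fun k => (expR (sg * s ord0 k / 2))%:C *: z k).
Proof.
move=> eta0 zB u; rewrite hnormE -rmorphXn -rmorphM /= sqr_sqrtr ?hsq_ge0//.
have -> : \sum_(k < n) `|dot u ((expR (sg * s ord0 k / 2))%:C *: z k)| ^+ 2 =
    (hsq dot u *
       \sum_k expR (sg * s ord0 k) * sqmod (dot (normalize u) (z k)))%:C.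
  rewrite mulr_sumr rmorph_sum; apply: eq_bigr => k _ /=.
  rewrite -{1}(normalizeK u) -sqmodE linearZl_LR linearZr_LR /= !sqmodM.
  rewrite !sqmod_real sqr_sqrtr ?hsq_ge0//; congr (_ * (_ * _))%:C.
  rewrite /sqmod /= oppr0 expr0n addr0 expr2 -expRD; congr expR; lra.
rewrite lecR mulrC ler_wpM2r ?hsq_ge0//; apply: le_trans (zB u).
by apply: ler_sum => k _; rewrite ler_wpM2l ?expR_ge0// lerDl.
Qed.

End Bessel.

(** * Keeping the coefficients away from zero *)

Lemma sqrtr_addX2_le (R : realType) (a b r : R) : 0 <= a -> 0 <= b -> 0 <= r ->
  sqrtr (a + r ^+ 2 * b) <= sqrtr a + r * sqrtr b.
Proof.
move=> a0 b0 r0; have rb0 : 0 <= r * sqrtr b by rewrite mulr_ge0// sqrtr_ge0.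
have sum0 : 0 <= sqrtr a + r * sqrtr b by rewrite addr_ge0// sqrtr_ge0.
rewrite -[leRHS]ger0_norm// -sqrtr_sqr ler_sqrt ?sqr_ge0//.
rewrite sqrrD exprMn !sqr_sqrtr// -addrA lerD2l lerDr.
by rewrite mulrn_wge0// mulr_ge0// sqrtr_ge0.
Qed.

(* Adding [r ^+ 2] to all the coefficients makes them bounded away from [0], at
   the cost of one more [C] on the right. *)
Lemma unconditional_perturbed_sum_le (R : realType) (H : vectType R[i])
    (dot : {dot H for conjC}) (n : nat) (C r : R) (x y : 'I_n -> H) :
  0 < C ->
  (forall (u : H) (eps : 'I_n -> R[i]),
     (forall k, `|eps k| <= 1) ->
     hnorm dot (\sum_(k < n) (eps k * dot u (y k)) *: x k)
       <= C%:C * hnorm dot u) ->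
  0 <= r ->
  \sum_k (r * (hlen dot (x k) + hlen dot (y k)) + r ^+ 2) <= C ->
  forall (m : nat) (u : 'I_m -> H) (la mu : 'I_m -> R),
  (forall i, hsq dot (u i) <= 1) ->
  (forall i, 0 <= la i) -> (forall i, 0 <= mu i) ->
  \sum_k sqrtr (\sum_i la i * (sqmod (dot (u i) (x k)) + r ^+ 2))
       * sqrtr (\sum_i mu i * (sqmod (dot (u i) (y k)) + r ^+ 2))
  <= 5 * C * (sqrtr (\sum_i la i) * sqrtr (\sum_i mu i)).
Proof.
move=> C0 xyC r0 rC m u la mu u1 la0 mu0.
set L := sqrtr (\sum_i la i); set M := sqrtr (\sum_i mu i).
have L0 : 0 <= L := sqrtr_ge0 _; have M0 : 0 <= M := sqrtr_ge0 _.
pose S (nu : 'I_m -> R) w := sqrtr (\sum_i nu i * sqmod (dot (u i) w)).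
have S0 nu w : 0 <= S nu w := sqrtr_ge0 _.
have split_le nu w : (forall i, 0 <= nu i) ->
    sqrtr (\sum_i nu i * (sqmod (dot (u i) w) + r ^+ 2))
    <= S nu w + r * sqrtr (\sum_i nu i).
  move=> nu0; under eq_bigr do rewrite mulrDr.
  rewrite big_split /= -mulr_suml [X in _ + X]mulrC.
  by apply: sqrtr_addX2_le => //; apply: sumr_ge0 => i _ //;
    rewrite mulr_ge0// sqmod_ge0.
have S_le nu w : (forall i, 0 <= nu i) ->
    S nu w <= hlen dot w * sqrtr (\sum_i nu i).
  move=> nu0; rewrite -sqrtrM ?hsq_ge0//; rewrite ler_sqrt; last first.
    by rewrite mulr_ge0 ?hsq_ge0 ?sumr_ge0.
  rewrite mulr_sumr; apply: ler_sum => i _.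
  rewrite mulrC ler_wpM2r//; apply: le_trans (sqmod_dot_le _ _ _) _.
  by rewrite ler_piMl ?hsq_ge0.
have hsq_le nu : (forall i, 0 <= nu i) ->
    sqrtr (\sum_i nu i * hsq dot (u i)) <= sqrtr (\sum_i nu i).
  move=> nu0; rewrite ler_sqrt ?sumr_ge0//; apply: ler_sum => i _.
  by rewrite ler_piMr.
have main : \sum_k S la (x k) * S mu (y k) <= 4 * C * (L * M).
  under eq_bigr do rewrite mulrC.
  apply: le_trans (unconditional_weighted_sum_le C0 xyC u mu0 la0) _.
  rewrite ler_pM2l ?mulr_gt0// [L * M]mulrC.
  by apply: ler_pM; rewrite ?sqrtr_ge0// hsq_le.
(* In the expanded product [(S la (x k) + r L) (S mu (y k) + r M)], [S_le] bounds the cross terms by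
   multiples of [L * M]. *)
apply: (@le_trans _ _ (\sum_k (S la (x k) * S mu (y k)
   + (r * (hlen dot (x k) + hlen dot (y k)) + r ^+ 2) * (L * M)))).
  apply: ler_sum => k _.
  have := ler_pM (sqrtr_ge0 _) (sqrtr_ge0 _) (split_le _ (x k) la0)
    (split_le _ (y k) mu0).
  move=> /le_trans; apply; rewrite -/L -/M.
  have := ler_wpM2l (mulr_ge0 r0 M0) (S_le _ (x k) la0).
  have := ler_wpM2l (mulr_ge0 r0 L0) (S_le _ (y k) mu0).
  by rewrite -/L -/M; lra.
rewrite big_split /= -mulr_suml.
have := ler_wpM2r (mulr_ge0 L0 M0) rC; lra.
Qed.

Theorem theorem2p2 (R : realType) :
  exists2 K : R, 0 < K &
    forall (H : vectType R[i]) (dot : {dot H for conjC})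
      (n : nat) (C : R) (x y : 'I_n -> H),
      (0 < n)%N -> 0 < C ->
      (forall (u : H) (eps : 'I_n -> R[i]),
         (forall k, `|eps k| <= 1) ->
         hnorm dot (\sum_(k < n) (eps k * dot u (y k)) *: x k)
           <= C%:C * hnorm dot u) ->
      exists2 alpha : 'I_n -> R[i], (forall k, alpha k != 0) &
        Bessel dot (C * K) (fun k => alpha k *: x k) /\
        Bessel dot (C * K) (fun k => (conjC (alpha k))^-1 *: y k).
Proof.
(* 20 is 4 from [balancing] times 5, where 5 is 4 from the two uses of Khinchine plus 1 for the
   perturbation. *)
exists 20 => // H dot n C x y _ C0 xyC.
pose N := \sum_k (hlen dot (x k) + hlen dot (y k) + 1).
have N0 : 0 <= N.
  by apply: sumr_ge0 => k _; rewrite addr_ge0// addr_ge0// hlen_ge0.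
(* This gives both [r <= 1] and [r * N <= C]; the summand 1 in [N] absorbs [r ^+ 2 <= r]. *)
pose r := C / (N + C).
have NC0 : 0 < N + C by rewrite ltr_wpDl.
have r0 : 0 < r by rewrite divr_gt0.
have r1 : r <= 1 by rewrite ler_pdivrMr// mul1r lerDr.
have rC : \sum_k (r * (hlen dot (x k) + hlen dot (y k)) + r ^+ 2) <= C.
  apply: (@le_trans _ _ (r * N)).
    rewrite mulr_sumr; apply: ler_sum => k _.
    by rewrite [leRHS]mulrDr mulr1 lerD2l expr2 ler_piMl// ltW.
  by rewrite mulrAC ler_pdivrMr// ler_pM2l// lerDl ltW.
have eta0 : 0 < r ^+ 2 by rewrite exprn_gt0.
pose a u k := sqmod (dot (normalize dot u) (x k)) + r ^+ 2.
pose b u k := sqmod (dot (normalize dot u) (y k)) + r ^+ 2.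
have aE u k : r ^+ 2 <= a u k by rewrite lerDr sqmod_ge0.
have bE u k : r ^+ 2 <= b u k by rewrite lerDr sqmod_ge0.
(* The index set is all of [H]; each finite subfamily of test vectors is settled by [balancing]. *)
have [|s sP] := @expsum_compactness R n H a b (r ^+ 2) (C * 20) eta0 aE bE.
  move=> m f m0.
  have -> : C * 20 = 4 * (5 * C) by ring.
  apply: (@balancing R m n (a \o f) (b \o f)) => //.
  - by move=> i k; exact: lt_le_trans eta0 (aE _ _).
  - by move=> i k; exact: lt_le_trans eta0 (bE _ _).
  - by rewrite mulr_gt0.
  - move=> la mu la0 mu0.
    apply: (unconditional_perturbed_sum_le C0 xyC (ltW r0) rC) => // i.
    exact: hsq_normalize_le1.
have alpha_gt0 k : 0 < expR (1 * s ord0 k / 2) by exact: expR_gt0.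
(* The multipliers are real and positive, so the conjugate inverse merely changes the sign of the
   exponent. *)
exists (fun k => (expR (1 * s ord0 k / 2))%:C).
  by move=> k; apply/eqP => /(@complexI R _ 0)/eqP; rewrite gt_eqF.
split.
  by apply: (Bessel_expsum (ltW eta0)) => u; exact: (sP u).1.
have conjV k : (conjC (expR (1 * s ord0 k / 2))%:C)^-1 =
    (expR (- 1 * s ord0 k / 2))%:C :> R[i].
  rewrite conj_Creal; last by apply/complex_realP; eexists.
  by rewrite -fmorphV -expRN mul1r mulN1r mulNr.
under eq_fun do rewrite conjV.
by apply: (Bessel_expsum (ltW eta0)) => u; exact: (sP u).2.
Qed.
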